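(* Let $g_1=v^{-4/3}g_s$ be a metric on $S^1$ with $v\in C^4(S^1)$, $v>0$, and let $\varphi\in C^4(S^1)$ with $\varphi>0$. If $g_2=\varphi^{-4/3}g_1$, then $$Q^A_{g_2}=\varphi^{5/3}P^A_{g_1}\varphi,$$ and $$P^A_{g_2}\psi=\varphi^{5/3}P^A_{g_1}(\psi\varphi)\qquad\text{for all }\psi\in C^4(S^1).$$
   Context: $S^1$ is the unit circle with angle $\theta$ and standard metric $g_s=d\theta\otimes d\theta$; functions on $S^1$ are $2\pi$-periodic functions of $\theta$. For a metric $g=d\sigma\otimes d\sigma=v^{-4/3}g_s$ with $v>0$ (so $d\sigma=v^{-2/3}d\theta$), put $\nabla_g=D_\sigma=v^{2/3}\frac{d}{d\theta}$ and $\Delta_g=D_{\sigma\sigma}=\nabla_g\nabla_g$. The $1$-scalar curvature of $g$ is $$\kappa_g=w^3(w_{\theta\theta}+w),\qquad w=v^{1/3},$$ the symmetric $Q$-curvature of $g$ is $$Q^A_g=\tfrac19v^{5/3}\big(v_{\theta\theta\theta\theta}+10v_{\theta\theta}+9v\big),$$ and the operator $P^A_g$ is $$P^A_g(f)=\tfrac19\Delta_g^2f+\tfrac{10}{9}\nabla_g(\kappa_g\nabla_gf)+Q^A_gf,\qquad f\in C^4(S^1).$$ *)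

(* Defs.v *)
From Stdlib Require Import Reals Lra.
From Coquelicot Require Import Coquelicot.
Open Scope R_scope.

(* A function on the unit circle is a 2*PI-periodic function of the angle. *)
Definition on_circle (f : R -> R) : Prop :=
  forall t : R, f (t + 2 * PI) = f t.

Definition Ck_circle (k : nat) (f : R -> R) : Prop :=
  on_circle f /\
  (forall (j : nat) (t : R), (j <= k)%nat -> ex_derive_n f j t) /\
  (forall t : R, continuous (Derive_n f k) t).

(* The metric g(t) dt (x) dt is represented by its coefficient g > 0. *)
Definition metric : Type := R -> R.

Definition g_s : metric := fun _ => 1.

Definition rescale (u : R -> R) (g : metric) : metric :=
  fun t => Rpower (u t) (-4/3) * g t.

(* The unique v > 0 with g = v^(-4/3) g_s; see [rescale_conf_factor] and
   [conf_factor_rescale]. *)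
Definition conf_factor (g : metric) : R -> R :=
  fun t => Rpower (g t) (-3/4).

(* D_sigma, where g = d sigma (x) d sigma *)
Definition grad (g : metric) (f : R -> R) : R -> R :=
  fun t => Rpower (conf_factor g t) (2/3) * Derive f t.

Definition lap (g : metric) (f : R -> R) : R -> R := grad g (grad g f).

Definition kappa (g : metric) : R -> R :=
  let w := fun t => Rpower (conf_factor g t) (1/3) in
  fun t => w t ^ 3 * (Derive_n w 2 t + w t).

Definition QA (g : metric) : R -> R :=
  let v := conf_factor g in
  fun t => 1/9 * Rpower (v t) (5/3)
           * (Derive_n v 4 t + 10 * Derive_n v 2 t + 9 * v t).

Definition PA (g : metric) (f : R -> R) : R -> R :=
  fun t => 1/9 * lap g (lap g f) t
           + 10/9 * grad g (fun s => kappa g s * grad g f s) t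
           + QA g t * f t.

Lemma rescale_conf_factor (g : metric) (t : R) :
  0 < g t -> rescale (conf_factor g) g_s t = g t.
Proof.
intros Hg; unfold rescale, conf_factor, g_s.
rewrite Rpower_mult; replace (-3/4 * (-4/3)) with 1 by field.
rewrite Rpower_1 by assumption; ring.
Qed.

Lemma conf_factor_rescale (v : R -> R) (t : R) :
  0 < v t -> conf_factor (rescale v g_s) t = v t.
Proof.
intros Hv; unfold rescale, conf_factor, g_s.
rewrite Rmult_1_r, Rpower_mult; replace (-4/3 * (-3/4)) with 1 by field.
now apply Rpower_1.
Qed.

(* Main.v *)
Require Import Defs.
From Stdlib Require Import Reals Lra Lia.
From Coquelicot Require Import Coquelicot.
Open Scope R_scope.

(** Put P u = (u'''' + 10 u'' + 9 u) / 9, the operator of the round metric.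
    The heart of the matter is that, for g = v^(-4/3) g_s,
      P^A_g f = v^(5/3) P (v f),
    which is a polynomial identity in w = v^(1/3), f and their derivatives,
    since D_sigma = w^2 d/dtheta. As Q^A_g = v^(5/3) P v by definition and
    g_2 = (v phi)^(-4/3) g_s, both transformation laws follow by comparing
    the factorizations of g_1 and g_2. *)

(** Naming the derivatives as functions turns each differential identity below into a polynomial one
    in independent symbols, within reach of [ring] or [field]. *)
Definition jet4 (f f1 f2 f3 f4 : R -> R) : Prop :=
  (forall t, is_derive f t (f1 t)) /\ (forall t, is_derive f1 t (f2 t)) /\
  (forall t, is_derive f2 t (f3 t)) /\ (forall t, is_derive f3 t (f4 t)).

Lemma Ck_circle_jet4 (f : R -> R) :
  Ck_circle 4 f ->
  jet4 f (Derive f) (Derive_n f 2) (Derive_n f 3) (Derive_n f 4).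
Proof.
intros [_ [Hf _]].
assert (H : forall k t, (k < 4)%nat ->
          is_derive (Derive_n f k) t (Derive_n f (S k) t)).
{ intros k t Hk; apply Derive_correct, (Hf (S k)); lia. }
split; [|split; [|split]]; intros t.
- apply (H 0%nat); lia.
- apply (H 1%nat); lia.
- apply (H 2%nat); lia.
- apply (H 3%nat); lia.
Qed.

(** Returns from jets to [Derive_n]. Only orders 2 and 4 are kept, those occurring in [P_round] and
    [kappa]. *)
Lemma jet4_Derive_n (f f1 f2 f3 f4 : R -> R) :
  jet4 f f1 f2 f3 f4 ->
  forall t, Derive_n f 2 t = f2 t /\ Derive_n f 4 t = f4 t.
Proof.
intros [H1 [H2 [H3 H4]]].
assert (E1 : forall t, Derive_n f 1 t = f1 t)
  by (intros t; exact (is_derive_unique _ _ _ (H1 t))).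
assert (E2 : forall t, Derive_n f 2 t = f2 t).
{ intros t; change (Derive (Derive_n f 1) t = f2 t).
  rewrite (Derive_ext _ _ t E1).
  exact (is_derive_unique _ _ _ (H2 t)). }
assert (E3 : forall t, Derive_n f 3 t = f3 t).
{ intros t; change (Derive (Derive_n f 2) t = f3 t).
  rewrite (Derive_ext _ _ t E2).
  exact (is_derive_unique _ _ _ (H3 t)). }
intros t; split; [apply E2|].
change (Derive (Derive_n f 3) t = f4 t).
rewrite (Derive_ext _ _ t E3).
exact (is_derive_unique _ _ _ (H4 t)).
Qed.

(** Differentiates by [auto_derive], then replaces every [Derive] by its named function. Side
    conditions such as positivity under [ln] or nonzero denominators are left to the caller. *)
Ltac derive_jets :=
  repeat match goal with H : jet4 _ _ _ _ _ |- _ =>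
    destruct H as [? [? [? ?]]] end;
  auto_derive;
  [ repeat split; try (eexists; eauto; fail)
  | repeat match goal with |- context [Derive ?f ?t] =>
      match goal with H : forall s, is_derive _ s _ |- _ =>
        rewrite (is_derive_unique f t _ (H t))
      end
    end ].

Lemma jet4_mult (f f1 f2 f3 f4 h h1 h2 h3 h4 : R -> R) :
  jet4 f f1 f2 f3 f4 -> jet4 h h1 h2 h3 h4 ->
  jet4 (fun t => f t * h t)
    (fun t => f1 t * h t + f t * h1 t)
    (fun t => f2 t * h t + 2 * f1 t * h1 t + f t * h2 t)
    (fun t => f3 t * h t + 3 * f2 t * h1 t + 3 * f1 t * h2 t + f t * h3 t)
    (fun t => f4 t * h t + 4 * f3 t * h1 t + 6 * f2 t * h2 t
              + 4 * f1 t * h3 t + f t * h4 t).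
Proof.
intros Hf Hh; (split; [|split; [|split]]); intros t; derive_jets; ring.
Qed.

Lemma jet4_cube (w w1 w2 w3 w4 : R -> R) :
  jet4 w w1 w2 w3 w4 ->
  jet4 (fun t => w t ^ 3)
    (fun t => 3 * w t ^ 2 * w1 t)
    (fun t => 6 * w t * w1 t ^ 2 + 3 * w t ^ 2 * w2 t)
    (fun t => 6 * w1 t ^ 3 + 18 * w t * w1 t * w2 t + 3 * w t ^ 2 * w3 t)
    (fun t => 36 * w1 t ^ 2 * w2 t + 18 * w t * w2 t ^ 2
              + 24 * w t * w1 t * w3 t + 3 * w t ^ 2 * w4 t).
Proof.
intros Hw; (split; [|split; [|split]]); intros t; derive_jets; ring.
Qed.

(* The derivatives of the cube root are obtained by solving the identities of
   [jet4_cube] successively for w1, w2, w3, w4. *)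
Lemma jet4_cbrt (v v1 v2 v3 v4 : R -> R) :
  jet4 v v1 v2 v3 v4 -> (forall t, 0 < v t) ->
  exists w1 w2 w3 w4, jet4 (fun t => Rpower (v t) (1/3)) w1 w2 w3 w4.
Proof.
intros Hv v_gt0.
set (w := fun t => Rpower (v t) (1/3)).
assert (w_neq0 : forall t, w t <> 0)
  by (intros t; apply Rgt_not_eq, exp_pos).
assert (wE : forall t, v t = w t ^ 3).
{ intros t; unfold w; rewrite <- Rpower_pow, Rpower_mult by apply exp_pos.
  replace (1/3 * INR 3) with 1 by (simpl; field).
  now rewrite Rpower_1. }
set (w1 := fun t => v1 t / (3 * w t ^ 2)).
set (w2 := fun t => (v2 t - 6 * w t * w1 t ^ 2) / (3 * w t ^ 2)).
set (w3 := fun t => (v3 t - 6 * w1 t ^ 3 - 18 * w t * w1 t * w2 t)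
                    / (3 * w t ^ 2)).
set (w4 := fun t => (v4 t - 36 * w1 t ^ 2 * w2 t - 18 * w t * w2 t ^ 2
                     - 24 * w t * w1 t * w3 t) / (3 * w t ^ 2)).
(* The real power is differentiated only here; the later derivatives come from the quotients
   defining [w1], [w2], [w3]. *)
assert (Hw : forall t, is_derive w t (w1 t)).
{ intros t; unfold w, Rpower; derive_jets.
  - now apply v_gt0.
  - change (exp (1 / 3 * ln (v t))) with (w t).
    unfold w1; rewrite wE; field; apply w_neq0. }
assert (Hw1 : forall t, is_derive w1 t (w2 t)).
{ intros t; unfold w1; derive_jets.
  - pose proof (w_neq0 t); nra.
  - unfold w2, w1; field; apply w_neq0. }
assert (Hw2 : forall t, is_derive w2 t (w3 t)).
{ intros t; unfold w2; derive_jets.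
  - pose proof (w_neq0 t); nra.
  - unfold w3, w2; field; apply w_neq0. }
assert (Hw3 : forall t, is_derive w3 t (w4 t)).
{ intros t; unfold w3; derive_jets.
  - pose proof (w_neq0 t); nra.
  - unfold w4, w3; field; apply w_neq0. }
now exists w1, w2, w3, w4.
Qed.

Definition P_round (u : R -> R) (t : R) : R :=
  1/9 * (Derive_n u 4 t + 10 * Derive_n u 2 t + 9 * u t).

Lemma P_round_ext (u u' : R -> R) (t : R) :
  (forall s, u s = u' s) -> P_round u t = P_round u' t.
Proof.
intros E; unfold P_round.
now rewrite !(Derive_n_ext u u' _ t E), E.
Qed.

Lemma QA_P_round (g : metric) (v : R -> R) (t : R) :
  (forall s, conf_factor g s = v s) ->
  QA g t = Rpower (v t) (5/3) * P_round v t.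
Proof.
intros E; unfold QA, P_round; cbv zeta.
rewrite !(Derive_n_ext _ v _ t E), E; ring.
Qed.

(** With v = w^3, the exponents 1/3, 2/3 and 5/3 become the natural powers 1, 2 and 5 of w. *)
Lemma Rpower_cube (x : R) (n : nat) :
  0 < x -> Rpower (x ^ 3) (INR n / 3) = x ^ n.
Proof.
intros Hx; rewrite <- !Rpower_pow, Rpower_mult by assumption.
f_equal; simpl (INR 3); field.
Qed.

(** This is D_sigma = w^2 d/dtheta. The function [F] is a closed form of [f], so that iterated
    gradients can be differentiated through explicit expressions. *)
Lemma grad_jet (g : metric) (w f F : R -> R) (t d : R) :
  conf_factor g t = w t ^ 3 -> 0 < w t ->
  (forall s, f s = F s) -> is_derive F t d ->
  grad g f t = w t ^ 2 * d.
Proof.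
intros Hg Hw E HF; unfold grad.
rewrite Hg, (Derive_ext _ _ t E), (is_derive_unique _ _ _ HF).
f_equal; rewrite <- (Rpower_cube (w t) 2) by assumption; f_equal; simpl; lra.
Qed.

Lemma PA_P_round_cube (g : metric) (w w1 w2 w3 w4 f f1 f2 f3 f4 : R -> R) :
  (forall t, conf_factor g t = w t ^ 3) -> (forall t, 0 < w t) ->
  jet4 w w1 w2 w3 w4 -> jet4 f f1 f2 f3 f4 ->
  forall t, PA g f t = w t ^ 5 * P_round (fun s => w s ^ 3 * f s) t.
Proof.
intros Hg w_gt0 Hw Hf.
assert (D1 : forall t, grad g f t = w t ^ 2 * f1 t).
{ intros t; apply grad_jet with f; auto; apply Hf. }
assert (D2 : forall t, lap g f t
             = 2 * w t ^ 3 * w1 t * f1 t + w t ^ 4 * f2 t).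
{ intros t; unfold lap; rewrite (grad_jet g w _ _ t
    (2 * w t * w1 t * f1 t + w t ^ 2 * f2 t) (Hg t) (w_gt0 t) D1).
  - ring.
  - derive_jets; ring. }
assert (D3 : forall t, grad g (lap g f) t
             = 6 * w t ^ 4 * w1 t ^ 2 * f1 t + 2 * w t ^ 5 * w2 t * f1 t
               + 6 * w t ^ 5 * w1 t * f2 t + w t ^ 6 * f3 t).
{ intros t; rewrite (grad_jet g w _ _ t
    (6 * w t ^ 2 * w1 t ^ 2 * f1 t + 2 * w t ^ 3 * w2 t * f1 t
     + 6 * w t ^ 3 * w1 t * f2 t + w t ^ 4 * f3 t) (Hg t) (w_gt0 t) D2).
  - ring.
  - derive_jets; ring. }
assert (D4 : forall t, lap g (lap g f) t
             = w t ^ 2 * (24 * w t ^ 3 * w1 t ^ 3 * f1 t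
               + 22 * w t ^ 4 * w1 t * w2 t * f1 t
               + 36 * w t ^ 4 * w1 t ^ 2 * f2 t + 2 * w t ^ 5 * w3 t * f1 t
               + 8 * w t ^ 5 * w2 t * f2 t + 12 * w t ^ 5 * w1 t * f3 t
               + w t ^ 6 * f4 t)).
{ intros t; apply (grad_jet g w _ _ t _ (Hg t) (w_gt0 t) D3).
  derive_jets; ring. }
assert (rootE : forall t, Rpower (conf_factor g t) (1/3) = w t).
{ intros t; rewrite Hg; change (1/3) with (INR 1 / 3).
  rewrite Rpower_cube by auto; ring. }
assert (K : forall t, kappa g t * grad g f t
            = (w t ^ 5 * w2 t + w t ^ 6) * f1 t).
{ intros t; rewrite D1; unfold kappa; cbv zeta.
  rewrite rootE, (Derive_n_ext _ w _ t rootE).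
  rewrite (proj1 (jet4_Derive_n _ _ _ _ _ Hw t)); ring. }
assert (DK : forall t, grad g (fun s => kappa g s * grad g f s) t
             = w t ^ 2 * ((5 * w t ^ 4 * w1 t * w2 t + w t ^ 5 * w3 t
                           + 6 * w t ^ 5 * w1 t) * f1 t
                          + (w t ^ 5 * w2 t + w t ^ 6) * f2 t)).
{ intros t; apply (grad_jet g w _ _ t _ (Hg t) (w_gt0 t) K).
  derive_jets; ring. }
intros t; unfold PA.
rewrite D4, DK, (QA_P_round g _ t Hg).
replace (Rpower (w t ^ 3) (5/3)) with (w t ^ 5)
  by (rewrite <- (Rpower_cube (w t) 5) by auto; f_equal; simpl; lra).
pose proof (jet4_cube _ _ _ _ _ Hw) as Hv.
pose proof (jet4_mult _ _ _ _ _ _ _ _ _ _ Hv Hf) as Hvf.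
destruct (jet4_Derive_n _ _ _ _ _ Hv t) as [V2 V4].
destruct (jet4_Derive_n _ _ _ _ _ Hvf t) as [F2 F4].
(* The terms in f itself are [QA g t * f t] on both sides. In the others, the curvature term
   supplies the 10 u'' part of P and completes the Leibniz coefficients: for instance 22 + 50 = 72
   for w w' w'' f', and 8 + 10 = 18 for w^2 w'' f''. *)
unfold P_round; rewrite V2, V4, F2, F4; field.
Qed.

(** The cubic form applied to w = v^(1/3), whose jet [jet4_cbrt] provides. *)
Lemma PA_P_round (g : metric) (v v1 v2 v3 v4 f f1 f2 f3 f4 : R -> R) :
  (forall t, conf_factor g t = v t) -> (forall t, 0 < v t) ->
  jet4 v v1 v2 v3 v4 -> jet4 f f1 f2 f3 f4 ->
  forall t, PA g f t = Rpower (v t) (5/3) * P_round (fun s => v s * f s) t.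
Proof.
intros Hg v_gt0 Hv Hf t.
destruct (jet4_cbrt _ _ _ _ _ Hv v_gt0) as [w1 [w2 [w3 [w4 Hw]]]].
assert (powE : forall s n, Rpower (v s) (1/3) ^ n = Rpower (v s) (INR n / 3)).
{ intros s n; rewrite <- Rpower_pow, Rpower_mult by apply exp_pos.
  f_equal; field. }
assert (cubeE : forall s, Rpower (v s) (1/3) ^ 3 = v s).
{ intros s; rewrite powE; replace (INR 3 / 3) with 1 by (simpl; field).
  now apply Rpower_1. }
rewrite (PA_P_round_cube g _ _ _ _ _ _ _ _ _ _
           (fun s => eq_trans (Hg s) (eq_sym (cubeE s)))
           (fun s => exp_pos _) Hw Hf).
rewrite powE; f_equal.
- f_equal; simpl; lra.
- apply P_round_ext; intros s; now rewrite cubeE.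
Qed.

(** Conformal factors multiply because u^(-4/3) v^(-4/3) = (v u)^(-4/3). *)
Lemma conf_factor_rescale_mult (g : metric) (u v : R -> R) (t : R) :
  0 < u t -> 0 < v t -> g t = rescale v g_s t ->
  conf_factor (rescale u g) t = v t * u t.
Proof.
intros Hu Hv Hg.
rewrite <- (conf_factor_rescale (fun s => v s * u s) t)
  by now apply Rmult_lt_0_compat.
unfold conf_factor; f_equal; unfold rescale in *; rewrite Hg.
rewrite <- Rpower_mult_distr by assumption; ring.
Qed.

Theorem proposition2 (g1 g2 : metric) (v phi : R -> R)
  (v_C4 : Ck_circle 4 v) (v_gt0 : forall t : R, 0 < v t)
  (g1E : forall t : R, g1 t = rescale v g_s t)
  (phi_C4 : Ck_circle 4 phi) (phi_gt0 : forall t : R, 0 < phi t)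
  (g2E : forall t : R, g2 t = rescale phi g1 t) :
  (forall t : R, QA g2 t = Rpower (phi t) (5/3) * PA g1 phi t) /\
  (forall psi : R -> R, Ck_circle 4 psi ->
   forall t : R,
     PA g2 psi t
     = Rpower (phi t) (5/3) * PA g1 (fun s => psi s * phi s) t).
Proof.
assert (c1 : forall t, conf_factor g1 t = v t).
{ intros t; rewrite <- (conf_factor_rescale v t) by auto.
  unfold conf_factor; now rewrite g1E. }
assert (c2 : forall t, conf_factor g2 t = v t * phi t).
{ intros t; rewrite <- (conf_factor_rescale_mult g1) by auto.
  unfold conf_factor; now rewrite g2E. }
apply Ck_circle_jet4 in v_C4; apply Ck_circle_jet4 in phi_C4.
split.
(* Both sides reduce to (v phi)^(5/3) P(v phi). *)
- intros t; rewrite (QA_P_round _ _ t c2).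
  rewrite (PA_P_round _ _ _ _ _ _ _ _ _ _ _ c1 v_gt0 v_C4 phi_C4).
  rewrite <- Rpower_mult_distr by auto; ring.
- intros psi Hpsi t; apply Ck_circle_jet4 in Hpsi.
  (* Factor v phi with argument psi on the left, factor v with argument psi phi on the right: P acts
     on the same product v phi psi. *)
  rewrite (PA_P_round _ _ _ _ _ _ _ _ _ _ _ c2
    (fun s => Rmult_lt_0_compat _ _ (v_gt0 s) (phi_gt0 s))
    (jet4_mult _ _ _ _ _ _ _ _ _ _ v_C4 phi_C4) Hpsi).
  rewrite (PA_P_round _ _ _ _ _ _ _ _ _ _ _ c1 v_gt0 v_C4
    (jet4_mult _ _ _ _ _ _ _ _ _ _ Hpsi phi_C4)).
  rewrite <- Rpower_mult_distr by auto.
  rewrite (P_round_ext (fun s => v s * (psi s * phi s))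
    (fun s => v s * phi s * psi s) t) by (intros s; ring).
  ring.
Qed.
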